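(* There is an absolute constant $c>0$ such that the following holds. Let $\mathcal{T}$ be a distribution-free Lipschitz $\tfrac12$-tester for functions $f:\{0,1\}^d\to[0,r]$. Then for all sufficiently large $d$ and all even integers $r$ with $4\le r\le 2^{-16}d$, either the worst-case sample complexity of $\mathcal{T}$ is at least $2^{cd}$, or its worst-case query complexity is at least $(d/r)^{cr}$ (i.e., there exist $f:\{0,1\}^d\to[0,r]$ and a distribution $D$ on $\{0,1\}^d$ on which $\mathcal{T}$ uses that many samples or queries).
   Context: The hypercube $\{0,1\}^d$ has Hamming distance $|x-y|$; $f$ is Lipschitz if $|f(x)-f(y)|\le|x-y|$ for all $x,y$, and $\mathrm{Lip}$ is the set of such functions. For a distribution $D$ on $\{0,1\}^d$, $\ell_{0,D}(f,\mathrm{Lip})=\min_{g\in\mathrm{Lip}}\Pr_{x\sim D}[f(x)\ne g(x)]$. For $\epsilon\in(0,1/2]$, a distribution-free Lipschitz $\epsilon$-tester is a randomized algorithm that gets query access to $f:\{0,1\}^d\to[0,r]$ and access to independent samples from an unknown distribution $D$ on $\{0,1\}^d$; if $f$ is Lipschitz it accepts with probability at least $2/3$, and if $\ell_{0,D}(f,\mathrm{Lip})\ge\epsilon$ it rejects with probability at least $2/3$. *)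

(* Defs.v *)
From Stdlib Require Import Reals.
From HB Require Import structures.
From mathcomp Require Import all_boot all_order all_algebra.
From mathcomp Require Import all_classical all_reals all_analysis.
From mathcomp Require Import Rstruct Rstruct_topology.

Set Implicit Arguments. Unset Strict Implicit. Unset Printing Implicit Defensive.
Import Order.TTheory GRing.Theory Num.Theory.
Local Open Scope ring_scope.
Local Open Scope classical_set_scope.

Definition point (d : nat) := (d.-tuple bool)%type.

Definition pt0 (d : nat) : point d := [tuple of nseq d false].

Definition hamming (d : nat) (x y : point d) : nat :=
  #|[set i : 'I_d | tnth x i != tnth y i]|.

Definition lipschitz (d : nat) (f : point d -> R) : Prop :=
  forall x y : point d, `|f x - f y| <= (hamming x y)%:R.

Definition ranged (d r : nat) (f : point d -> R) : Prop :=
  forall x : point d, 0 <= f x <= r%:R.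

Definition is_distr (d : nat) (D : point d -> R) : Prop :=
  (forall x, 0 <= D x) /\ \sum_(x : point d) D x = 1.

Definition pr_neq (d : nat) (D : point d -> R) (f g : point d -> R) : R :=
  \sum_(x : point d | f x != g x) D x.

Definition far (d : nat) (f : point d -> R) (D : point d -> R) (eps : R) : Prop :=
  forall g : point d -> R, lipschitz g -> eps <= pr_neq D f g.

(** Model of a randomized tester.  For each random seed, a deterministic
    adaptive strategy maps the history of answers so far to the next action:
    query f at a point, draw a sample from D, or halt with a verdict. *)
Inductive action (d : nat) : Type :=
  | AQuery of point d
  | ASample
  | AAccept
  | AReject.
Arguments ASample {d}. Arguments AAccept {d}. Arguments AReject {d}.

Inductive response (d : nat) : Type :=
  | RVal of R
  | RPt of point d.

Definition strategy (d : nat) := (seq (response d) -> action d)%type.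

(** Execution with [fuel] steps; [ss n] is the n-th independent sample.
    Returns (verdict, #queries, #samples), or None if fuel ran out. *)
Fixpoint run (d : nat) (st : strategy d) (f : point d -> R) (ss : nat -> point d)
    (fuel : nat) (hist : seq (response d)) (nq ns : nat) : option (bool * nat * nat) :=
  match fuel with
  | 0 => None
  | fuel'.+1 =>
    match st hist with
    | AAccept => Some (true, nq, ns)
    | AReject => Some (false, nq, ns)
    | AQuery x => run st f ss fuel' (rcons hist (RVal d (f x))) nq.+1 ns
    | ASample => run st f ss fuel' (rcons hist (RPt (ss ns))) nq ns.+1
    end
  end.

Definition run0 (d : nat) (st : strategy d) (f : point d -> R) (ss : nat -> point d)
    (s q : nat) : option (bool * nat * nat) :=
  run st f ss (s + q).+1 [::] 0 0.

Definition complexity_bounded (d r : nat) (Omega : Type)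
    (T : Omega -> strategy d) (s q : nat) : Prop :=
  forall (w : Omega) (f : point d -> R), ranged r f ->
  forall ss : nat -> point d,
  exists b nq ns, run0 (T w) f ss s q = Some (b, nq, ns) /\ (nq <= q)%N /\ (ns <= s)%N.

Definition verdict_event (d : nat) (Omega : Type) (T : Omega -> strategy d)
    (f : point d -> R) (ss : nat -> point d) (s q : nat) (b : bool) : set Omega :=
  [set w | exists nq ns, run0 (T w) f ss s q = Some (b, nq, ns)].

Definition seq_of_tuple (d s : nat) (t : s.-tuple (point d)) : nat -> point d :=
  fun n => nth (pt0 d) t n.

(** Probability of verdict b when at most s samples are used: the samples are
    s i.i.d. draws from D, and the seed is drawn from P independently. *)
Definition verdict_prob (d : nat) (md : measure_display) (Omega : measurableType md)
    (P : probability Omega R) (T : Omega -> strategy d)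
    (f : point d -> R) (D : point d -> R) (s q : nat) (b : bool) : R :=
  \sum_(t : s.-tuple (point d))
     (\prod_(i < s) D (tnth t i)) * fine (P (verdict_event T f (seq_of_tuple t) s q b)).

Definition measurable_tester (d r : nat) (md : measure_display) (Omega : measurableType md)
    (T : Omega -> strategy d) (s q : nat) : Prop :=
  forall f : point d -> R, ranged r f -> forall (ss : nat -> point d) (b : bool),
    measurable (verdict_event T f ss s q b).

Definition lip_tester (d r : nat) (md : measure_display) (Omega : measurableType md)
    (P : probability Omega R) (T : Omega -> strategy d) (s q : nat) (eps : R) : Prop :=
  (forall f D, ranged r f -> is_distr D -> lipschitz f ->
     2 / 3 <= verdict_prob P T f D s q true) /\
  (forall f D, ranged r f -> is_distr D -> far f D eps ->
     2 / 3 <= verdict_prob P T f D s q false).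

(* Main.v *)
Require Import Defs.
From Stdlib Require Import Reals.
From HB Require Import structures.
From mathcomp Require Import all_boot all_order all_algebra.
From mathcomp Require Import all_classical all_reals all_analysis.
From mathcomp Require Import Rstruct Rstruct_topology.
From mathcomp Require Import measurable_realfun zify ring lra.
Import Order.TTheory GRing.Theory Num.Theory.
Local Open Scope ring_scope.

Set Implicit Arguments.
Unset Strict Implicit.
Unset Printing Implicit Defensive.

(** Write [r = 2k] and draw [m] pairs [(x_i, y_i)], where the [x_i] are independent
    uniform points of the cube and [y_i] flips a random set of [w] coordinates of [x_i].
    Let [f] be [k] plus a cone of height [k] at every [x_i] minus a cone of depth [k] at
    every [y_i], and let [D] be uniform on the [2m] ends.  Once the [x_i] are far apart,
    [w = r] makes [f] Lipschitz, whereas [w = r - 1] makes every pair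
    [f x_i = r], [f y_i = 0] a violation, so that [f] is 1/2-far under [D].

    A tester cannot tell the two cases apart.  With [m >> s^2] it does not sample both ends
    of a pair, and each sampled end on its own is a uniform point whatever [w] is.  Hence
    the values of [w] can only be told apart by a query within distance [k] of an end which
    was not sampled.  Ends of unsampled pairs are uniform and too rare in the cube.  A query
    has at most one sampled point nearby, and it comes close to the other end of that pair
    with probability at most [(4r/d)^(r/2)], since [w]-sets close to a common point pairwise
    share [k] elements. *)

(** * Averages over finite types *)

Definition avg (K : realFieldType) (T : finType) (F : T -> K) : K := #|T|%:R^-1 * \sum_t F t.

Section Average.
Variables (K : realFieldType) (T : finType).
Implicit Types F G : T -> K.

Lemma eq_avg F G : F =1 G -> avg F = avg G.
Proof. by move=> FG; rewrite /avg (eq_bigr G). Qed.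

Lemma avg_le F G : (forall t, F t <= G t) -> avg F <= avg G.
Proof. by move=> FG; rewrite ler_wpM2l ?invr_ge0 ?ler0n// ler_sum. Qed.

Lemma avgD F G : avg (fun t => F t + G t) = avg F + avg G.
Proof. by rewrite /avg big_split/= mulrDr. Qed.

Lemma avgB F G : avg (fun t => F t - G t) = avg F - avg G.
Proof. by rewrite /avg sumrB mulrBr. Qed.

Lemma avg_sum (I : Type) (r : seq I) (P : pred I) (F : I -> T -> K) :
  avg (fun t => \sum_(i <- r | P i) F i t) = \sum_(i <- r | P i) avg (F i).
Proof. by rewrite /avg exchange_big mulr_sumr. Qed.

Lemma avgZ (c : K) F : avg (fun t => c * F t) = c * avg F.
Proof. by rewrite /avg -mulr_sumr mulrCA. Qed.

Lemma avg_cst (c : K) : (0 < #|T|)%N -> avg (fun _ : T => c) = c.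
Proof.
move=> T0; rewrite /avg sumr_const -(mulr_natl c) mulrA mulVf ?mul1r//.
by rewrite pnatr_eq0 -lt0n.
Qed.

Lemma avg_le_cst (c : K) F : (0 < #|T|)%N -> (forall t, F t <= c) -> avg F <= c.
Proof. by move=> T0 Fc; rewrite -[leRHS](avg_cst c T0) avg_le. Qed.

Lemma avg_pred (P : pred T) : avg (fun t => (P t)%:R : K) = #|P|%:R / #|T|%:R.
Proof.
rewrite /avg mulrC; congr (_ / _).
rewrite -sum1_card natr_sum [RHS]big_mkcond/=.
by apply: eq_bigr => t _; rewrite unfold_in; case: (P t).
Qed.

Lemma reindex_avg (h : T -> T) F : injective h -> avg F = avg (F \o h).
Proof. by move=> hI; rewrite /avg (reindex_inj hI). Qed.

End Average.

Lemma exchange_avg (K : realFieldType) (S T : finType) (F : S -> T -> K) :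
  avg (fun s => avg (F s)) = avg (fun t => avg (F^~ t)).
Proof. by rewrite /avg -!mulr_sumr exchange_big/= mulrCA. Qed.

Lemma pair_avg (K : realFieldType) (S T : finType) (F : S -> T -> K) :
  avg (fun s => avg (F s)) = avg (fun u : S * T => F u.1 u.2).
Proof.
by rewrite /avg card_prod natrM invfM -mulr_sumr mulrA pair_bigA.
Qed.

Section Coordinate.
Variables (K : realFieldType) (I A : finType).
Implicit Types x : {ffun I -> A}.

Definition upd x i a : {ffun I -> A} := [ffun j => if j == i then a else x j].

Lemma upd_same x i a : upd x i a i = a.
Proof. by rewrite ffunE eqxx. Qed.

Lemma upd_other x i a j : j != i -> upd x i a j = x j.
Proof. by rewrite ffunE => /negPf->. Qed.

(* The exchange (x, a) |-> (x[i := a], x i) is an involution. *)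
Lemma avg_upd i (G : {ffun I -> A} -> K) : (0 < #|A|)%N ->
  avg G = avg (fun x => avg (fun a => G (upd x i a))).
Proof.
move=> A0; rewrite (pair_avg (fun x a => G (upd x i a))).
pose h (u : {ffun I -> A} * A) := (upd u.1 i u.2, u.1 i).
have hK : involutive h.
  move=> [x a]; rewrite /h/= upd_same; congr pair.
  by apply/ffunP => j; rewrite !ffunE; case: eqP => // ->.
rewrite -(reindex_avg (fun u => G u.1) (inv_inj hK)) -(pair_avg (fun x _ => G x)).
by apply: eq_avg => x; rewrite avg_cst.
Qed.

Lemma avg_coord_le i (G : {ffun I -> A} -> K) (c : K) : (0 < #|A|)%N ->
  (forall x, avg (fun a => G (upd x i a)) <= c) -> avg G <= c.
Proof.
move=> A0 Gc; rewrite (avg_upd i)//; apply: avg_le_cst => //.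
by rewrite card_ffun expn_gt0 A0.
Qed.

End Coordinate.

Lemma natr_exists_le (K : realFieldType) (I : finType) (P : pred I) :
  [exists i, P i]%:R <= \sum_i (P i)%:R :> K.
Proof.
case: existsP => [[i Pi]|_]; last by rewrite sumr_ge0// => i _; rewrite ler0n.
by rewrite (bigD1 i)//= Pi lerDl sumr_ge0// => j _; rewrite ler0n.
Qed.

Lemma natr_has_le (K : realFieldType) (A : Type) (P : pred A) (s : seq A) :
  (has P s)%:R <= \sum_(a <- s) (P a)%:R :> K.
Proof.
elim: s => [|a s IH] /=; first by rewrite big_nil.
by rewrite big_cons; apply: le_trans (lerD (lexx _) IH); case: (P a) (has P s) => [] [] /=; lra.
Qed.

Lemma sumr_seq_le (K : realFieldType) (A : Type) (s : seq A) (F : A -> K) (c : K) :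
  (forall a, F a <= c) -> \sum_(a <- s) F a <= (size s)%:R * c.
Proof.
move=> Fc; elim: s => [|a s IH]; first by rewrite big_nil mul0r.
by rewrite big_cons/= -natr1 mulrDl mul1r addrC lerD.
Qed.

(** * Averaging over the random seed *)

Section Mixture.
Variables (md : measure_display) (Omega : measurableType md).
Variables (R : realType) (P : probability Omega R).

(** The weighted sum of probabilities is the integral over [w] of the weighted sum of indicators, so
    a bound for each fixed seed suffices. This reduces a randomized tester to deterministic
    strategies. *)
Lemma sum_prob_le (T : finType) (c : T -> R) (E : T -> set Omega) (C : R) :
  (forall t, 0 <= c t) -> (forall t, measurable (E t)) ->
  (forall w, \sum_t c t * (`[< E t w >])%:R <= C) ->
  \sum_t c t * fine (P (E t)) <= C.
Proof.
move=> c0 mE EC.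
pose i t : Omega -> \bar R := fun w => (\1_(E t) w)%:E.
pose f t : Omega -> \bar R := fun w => ((c t)%:E * i t w)%E.
have mi t : measurable_fun setT (i t).
  by apply/measurable_EFinP; exact: measurable_indic.
have i0 t w : (0 <= i t w)%E by rewrite lee_fin indicE ler0n.
have mf t : measurable_fun setT (f t) by exact: measurable_funeM.
have f0 t w : (0 <= f t w)%E by rewrite mule_ge0// lee_fin.
rewrite -lee_fin -sumEFin.
have -> : (\sum_t (c t * fine (P (E t)))%:E =
    \int[P]_(w in setT) \sum_(t <- index_enum T) f t w)%E.
  rewrite ge0_integral_sum//; apply: eq_bigr => t _.
  rewrite ge0_integralZl_EFin// integral_indic// setIT EFinM fineK//.
  exact: fin_num_measure.
apply: (@le_trans _ _ (\int[P]_(w in setT) (cst C%:E w))%E).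
  apply: ge0_le_integral => //.
  - by move=> w _; exact: sume_ge0.
  - exact: emeasurable_sum.
  - move=> w _; rewrite sumEFin lee_fin; apply: le_trans (EC w).
    by apply: ler_sum => t _; rewrite indicE; exact: lexx.
by rewrite integral_cst// [X in (_ * X)%E]probability_setT mule1.
Qed.

(** The hypothesis bounds the two averages only jointly, so they are treated as one weighted sum
    over the disjoint union [S + T]. *)
Lemma avg_prob_le (S T : finType) (E : S -> set Omega) (F : T -> set Omega) (C : R) :
  (forall s, measurable (E s)) -> (forall t, measurable (F t)) ->
  (forall w, avg (fun s => (`[< E s w >])%:R : R) + avg (fun t => (`[< F t w >])%:R) <= C) ->
  avg (fun s => fine (P (E s))) + avg (fun t => fine (P (F t))) <= C.
Proof.
move=> mE mF EFC.
pose G (u : S + T) := match u with inl s => E s | inr t => F t end.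
pose c (u : S + T) : R :=
  match u with inl _ => #|S|%:R^-1 | inr _ => #|T|%:R^-1 end.
have := @sum_prob_le (S + T)%type c G C.
rewrite big_sumType/= -!mulr_sumr; apply.
- by case=> ?; rewrite /= invr_ge0 ler0n.
- by case.
- by move=> w; rewrite big_sumType/= -!mulr_sumr; exact: EFC.
Qed.

End Mixture.

(** * Hamming balls and sets of fixed size *)

Section Cube.
Variable d : nat.
Implicit Types (x y z p : Defs.point d) (A B S : {set 'I_d}).

Lemma hammingE x y : hamming x y = #|[pred i | tnth x i != tnth y i]|.
Proof.
apply: eq_card => i; rewrite !inE; apply/idP/idP; first by rewrite inE.
by move=> xy; rewrite inE.
Qed.

Definition shift x S : Defs.point d := [tuple tnth x i (+) (i \in S) | i < d].

Lemma tnth_shift x S i : tnth (shift x S) i = tnth x i (+) (i \in S).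
Proof. by rewrite tnth_mktuple. Qed.

Lemma shiftK S : involutive (shift^~ S).
Proof.
by move=> x; apply: eq_from_tnth => i; rewrite !tnth_shift -addbA addbb addbF.
Qed.

Lemma hammingC x y : hamming x y = hamming y x.
Proof. by rewrite !hammingE; apply: eq_card => i; rewrite !inE eq_sym. Qed.

Lemma hammingxx x : hamming x x = 0%N.
Proof. by rewrite hammingE; apply: eq_card0 => i; rewrite !inE eqxx. Qed.

Lemma hamming_triangle y x z : (hamming x z <= hamming x y + hamming y z)%N.
Proof.
rewrite !hammingE -cardUI; apply: leq_trans (leq_addr _ _).
apply/subset_leq_card/fintype.subsetP => i; rewrite !inE.
by case: (tnth x i) (tnth y i) (tnth z i) => [] [] [].
Qed.

Lemma hamming_shift x S : hamming x (shift x S) = #|S|.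
Proof.
rewrite hammingE; apply: eq_card => i; rewrite !inE tnth_shift.
by case: (tnth x i) (i \in S) => [] [].
Qed.

Lemma hamming_shift2 x A B :
  (hamming (shift x A) (shift x B) + (#|A :&: B|).*2)%N = (#|A| + #|B|)%N.
Proof.
have -> : hamming (shift x A) (shift x B) = (#|A :\: B| + #|B :\: A|)%N.
  rewrite hammingE -cardUI [X in (_ + X)%N]eq_card0 ?addn0; last first.
    by move=> i; rewrite !inE; case: (i \in A) (i \in B) => [] [].
  apply: eq_card => i; rewrite !inE !tnth_shift.
  by case: (tnth x i) (i \in A) (i \in B) => [] [] [].
rewrite -(cardsID B A) -(cardsID A B) (finset.setIC B A); lia.
Qed.

Lemma card_point : #|{: Defs.point d}| = (2 ^ d)%N.
Proof. by rewrite card_tuple card_bool. Qed.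

End Cube.

Definition hball d (z : Defs.point d) t : pred (Defs.point d) :=
  [pred p | hamming z p < t]%N.

Lemma hball_set d (z : Defs.point d) t :
  #|hball z t| = #|[set S : {set 'I_d} | #|S| < t]%N|.
Proof.
have inj : injective (shift z).
  by move=> A B AB; apply/setP => i; move: (congr1 (@tnth d bool ^~ i) AB);
    rewrite /= !tnth_shift => /addbI.
rewrite -(card_imset _ inj); apply: eq_card => p; rewrite inE.
apply/idP/imsetP => [zp|[S]].
  exists [set i | tnth z i != tnth p i]; last first.
    apply: eq_from_tnth => i; rewrite tnth_shift inE.
    by case: (tnth z i) (tnth p i) => [] [].
  by rewrite inE; move: zp; rewrite hammingE cardsE.
by rewrite inE => St ->; rewrite hamming_shift.
Qed.

(* Chernoff: weigh each set S by 16^(d-|S|); the total weight is 17^d. *)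
Lemma hball_bound d (z : Defs.point d) t : (t <= d)%N ->
  (#|hball z t| * 16 ^ (d - t) <= 17 ^ d)%N.
Proof.
move=> td; rewrite hball_set.
have -> : (17 ^ d = \sum_(S : {set 'I_d}) 16 ^ (d - #|S|))%N.
  (* Grouping the sets by size turns the sum into the binomial expansion of [(16 + 1) ^ d]. *)
  rewrite (partition_big (fun S : {set 'I_d} => inord #|S| : 'I_d.+1) predT)//=.
  rewrite (expnDn 16 1); apply: eq_bigr => i _; rewrite exp1n muln1.
  rewrite (eq_bigr (fun=> 16 ^ (d - i))%N) => [|S /eqP <-]; last first.
    by rewrite inordK// ltnS -[leqRHS]card_ord max_card.
  rewrite sum_nat_const; congr muln.
  have := cards_draws [set: 'I_d] i; rewrite cardsT card_ord => <-.
  rewrite -[RHS]cardsE; apply: eq_card => S; rewrite !inE finset.subsetT/=.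
  rewrite [RHS]unfold_in eqnE inordK// ltnS -[leqRHS]card_ord.
  exact: max_card.
rewrite -sum_nat_const [leqRHS](bigID (mem [set S : {set 'I_d} | #|S| < t]%N))/=.
apply: leq_trans (leq_addr _ _); apply: leq_sum => S; rewrite inE => St.
by rewrite leq_pexp2l//; lia.
Qed.

Lemma leq_exp m n e : (m <= n -> m ^ e <= n ^ e)%N.
Proof. by move=> mn; case: e => // e; rewrite leq_exp2r. Qed.

(** The quotient of the binomials is the product of [(m - i) / (n - i)] over [i < a], and each
    factor is at most [m / n]. Denominators are cleared to stay in the naturals. *)
Lemma bin_ratio a n m : (a <= m)%N -> (m <= n)%N ->
  (n ^ a * 'C(n - a, m - a) <= m ^ a * 'C(n, m))%N.
Proof.
elim: a n m => [|a IH] n m; first by rewrite !subn0.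
case: n m => [|n] [|m]// am mn.
have := IH n m am mn; rewrite !subSS => {}IH.
have E : (n.+1 * 'C(n, m) = m.+1 * 'C(n.+1, m.+1))%N by rewrite -mul_bin_diag.
have [n0|n0] := posnP n.
  have -> : m = 0%N by lia. have -> : a = 0%N by lia. by rewrite n0.
(* This is [m / n <= (m + 1) / (n + 1)], which raises the ratio of the induction hypothesis to the
   one wanted. *)
have H : ((m * n.+1) ^ a <= (m.+1 * n) ^ a)%N by apply: leq_exp; lia.
rewrite -(@leq_pmul2l (n ^ a)) ?expn_gt0 ?n0//.
have -> : (n ^ a * (m.+1 ^ a.+1 * 'C(n.+1, m.+1)) = (m.+1 * n) ^ a * (n.+1 * 'C(n, m)))%N.
  by rewrite E expnMn expnS; lia.
apply: (@leq_trans ((m * n.+1) ^ a * (n.+1 * 'C(n, m)))%N); last by rewrite leq_mul2r H orbT.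
have -> : (n ^ a * (n.+1 ^ a.+1 * 'C(n - a, m - a)) =
  n.+1 ^ a.+1 * (n ^ a * 'C(n - a, m - a)))%N by lia.
have -> : ((m * n.+1) ^ a * (n.+1 * 'C(n, m)) = n.+1 ^ a.+1 * (m ^ a * 'C(n, m)))%N.
  by rewrite expnMn expnS; lia.
by rewrite leq_mul2l IH orbT.
Qed.

Lemma card_supset d (A : {set 'I_d}) w : (#|A| <= w)%N ->
  (#|[set S : {set 'I_d} | A \subset S & #|S| == w]| <= 'C(d - #|A|, w - #|A|))%N.
Proof.
move=> Aw.
have -> : 'C(d - #|A|, w - #|A|) = #|[set B : {set 'I_d} | B \subset ~: A & #|B| == (w - #|A|)%N]|.
  by rewrite cards_draws [#|~: A|]cardsCs finset.setCK card_ord.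
rewrite -(@card_in_imset _ _ (fun S => S :\: A)).
  apply/subset_leq_card/fintype.subsetP => B /imsetP[S]; rewrite inE => /andP[AS /eqP Sw] ->.
  rewrite inE finset.setDE finset.subsetIr/= -finset.setDE cardsD (finset.setIidPr AS) Sw eqxx //.
move=> S S'; rewrite !inE => /andP[AS _] /andP[AS' _] E.
by rewrite -(finset.setID S A) -(finset.setID S' A) E (finset.setIidPr AS) (finset.setIidPr AS').
Qed.

(* Two w-sets within distance k of the same point differ in fewer than 2k positions, so
   they share at least k elements; hence all of them contain a k-subset of one of them. *)
Lemma near_sets_bound d k w (z p : Defs.point d) :
  (2 * k <= w.+1)%N -> (w <= d)%N ->
  (#|[set S : {set 'I_d} | #|S| == w & hamming z (shift p S) < k]%N| * d ^ k
    <= 2 ^ w * w ^ k * 'C(d, w))%N.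
Proof.
move=> kw wd; set N := [set S : {set 'I_d} | _].
have [->|[S0]] := finset.set_0Vmem N; first by rewrite cards0.
rewrite inE => /andP[/eqP S0w zS0].
pose K := [set A : {set 'I_d} | A \subset S0 & #|A| == k].
pose U (A : {set 'I_d}) := [set S : {set 'I_d} | A \subset S & #|S| == w].
have NU : N \subset \bigcup_(A in K) U A.
  apply/fintype.subsetP => S; rewrite inE => /andP[/eqP Sw zS].
  have := hamming_triangle z (shift p S) (shift p S0).
  rewrite (hammingC (shift p S) z) => h.
  have h2 := hamming_shift2 p S S0.
  have : (0 < 'C(#|S :&: S0|, k))%N by rewrite bin_gt0; lia.
  rewrite -cards_draws => /card_gt0P[A]; rewrite inE finset.subsetI => /andP[/andP[AS AS0] Ak].
  by apply/finset.bigcupP; exists A; rewrite inE ?AS0 ?AS ?Sw ?eqxx.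
have Kc : (#|K| <= 2 ^ w)%N.
  rewrite -S0w -card_powerset; apply/subset_leq_card/fintype.subsetP => A.
  by rewrite !inE => /andP[].
have Nc : (#|N| <= \sum_(A in K) 'C(d - k, w - k))%N.
  apply: leq_trans (subset_leq_card NU) _.
  apply: (big_ind2 (fun (B : {set {set 'I_d}}) n => #|B| <= n)%N); first by rewrite cards0.
    by move=> B1 n1 B2 n2 Bn1 Bn2; rewrite cardsU; lia.
  move=> A; rewrite inE => /andP[_ /eqP Ak].
  by rewrite -Ak card_supset// Ak; lia.
rewrite sum_nat_const in Nc.
apply: (@leq_trans (#|K| * 'C(d - k, w - k) * d ^ k)%N); first by rewrite leq_mul2r Nc orbT.
rewrite -!mulnA leq_mul// mulnC bin_ratio//; lia.
Qed.

(** * Hard instances *)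

Lemma sumr_indicator (K : realFieldType) (T : finType) (P : pred T) (a : T) :
  \sum_(p | P p) (a == p)%:R = (P a)%:R :> K.
Proof.
have [Pa|Pa] := boolP (P a).
  rewrite (bigD1 a)//= eqxx big1 ?addr0// => p /andP[_].
  by rewrite eq_sym => /negPf->.
by rewrite big1// => p Pp; case: eqP => // E; rewrite E Pp in Pa.
Qed.

Lemma avg_bool (K : realFieldType) (F : bool -> K) : avg F = (F true + F false) / 2.
Proof. by rewrite /avg card_bool big_bool mulrC. Qed.

Lemma half_le_or (K : realFieldType) (u v : bool) :
  u || v -> 1 / 2 <= (u%:R + v%:R) / 2 :> K.
Proof. by case: u v => [] [] //= _; lra. Qed.

(** Independent samples from the image of a uniform label are images of independent uniform labels.
    The labels [J] record which pair and which end each sample came from, which the points alone do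
    not show. *)
Lemma empirical_sample (K : realFieldType) (A B : finType) (pt : A -> B) s
    (g : s.-tuple B -> K) :
  \sum_t (\prod_(i < s) avg (fun a => (pt a == tnth t i)%:R)) * g t =
  avg (fun J : {ffun 'I_s -> A} => g [tuple pt (J i) | i < s]).
Proof.
rewrite /avg card_ffun card_ord natrX -exprVn mulr_sumr.
under eq_bigr => t _.
  rewrite big_split/= prodr_const card_ord bigA_distr_bigA/= -mulrA mulr_suml mulr_sumr; over.
rewrite exchange_big; apply: eq_bigr => J _; rewrite -mulr_sumr; congr (_ * _).
rewrite (bigD1 [tuple pt (J i) | i < s])//= big1 ?mul1r => [|i _]; last first.
  by rewrite tnth_mktuple eqxx.
rewrite big1 ?addr0// => t tJ.
have /existsP[i it] : [exists i, tnth t i != pt (J i)].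
  apply: contraR tJ; rewrite negb_exists => /forallP tJ.
  apply/eqP/eq_from_tnth => i; rewrite tnth_mktuple; apply/eqP.
  by have := tJ i; rewrite negbK.
by rewrite (bigD1 i)//= eq_sym (negPf it) !mul0r.
Qed.

Lemma bigmax_pos (A : finType) (P : pred A) (F : A -> nat) :
  (0 < \max_(a | P a) F a)%N -> exists2 a, P a & \max_(a | P a) F a = F a.
Proof.
move=> F0; case: (pickP P) => [a Pa|P0]; last by rewrite big_pred0 in F0.
have [|b Pb ->] := @eq_bigmax_cond _ P F; last by exists b.
by apply/card_gt0P; exists a.
Qed.

Section Landscape.
Variables (d k m : nat).
Implicit Types (Q : pred ('I_m * bool)) (pt : 'I_m * bool -> Defs.point d).

(* Label false marks the peaks (height up to 2k), label true the valleys. *)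
Definition landscape Q pt z : nat :=
  (k + \max_(a | Q a && ~~ a.2) (k - hamming z (pt a))
     - \max_(a | Q a && a.2) (k - hamming z (pt a)))%N.

Definition landscapeR Q pt : Defs.point d -> R := fun z => (landscape Q pt z)%:R.

Lemma landscape_ranged Q pt : ranged (2 * k) (landscapeR Q pt).
Proof.
move=> z; rewrite ler0n ler_nat /landscape.
have : (\max_(a | Q a && ~~ a.2) (k - hamming z (pt a)) <= k)%N.
  by apply/bigmax_leqP => a _; exact: leq_subr.
lia.
Qed.

Lemma eq_landscape Q pt pt' z : (forall a, Q a -> pt a = pt' a) ->
  landscape Q pt z = landscape Q pt' z.
Proof.
move=> E; rewrite /landscape; congr (_ + _ - _)%N;
  by apply: eq_bigr => a /andP[/E->].
Qed.

(** At distance [k] or more the truncated difference [k - hamming z (pt a)] is 0, so such an end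
    does not change a maximum. *)
Lemma landscape_restrict Q pt z : (forall a, ~~ Q a -> k <= hamming z (pt a))%N ->
  landscape predT pt z = landscape Q pt z.
Proof.
move=> far; have H (P : pred ('I_m * bool)) :
    (\max_(a | P a) (k - hamming z (pt a)) = \max_(a | Q a && P a) (k - hamming z (pt a)))%N.
  rewrite big_mkcond [RHS]big_mkcond; apply: eq_bigr => a _.
  case: (boolP (Q a)) => //= /far ka; case: (P a) => //; lia.
by rewrite /landscape -!H.
Qed.

End Landscape.

Definition wset d w := {S : {set 'I_d} | #|S| == w}.

Lemma card_wset d w : #|{: wset d w}| = 'C(d, w).
Proof.
rewrite card_sig; have := cards_draws [set: 'I_d] w; rewrite cardsT card_ord => <-.
by rewrite -[LHS]cardsE; apply: eq_card => S; rewrite !inE finset.subsetT.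
Qed.

Definition separated d m t (x : {ffun 'I_m -> Defs.point d}) :=
  [forall i, forall j, (i != j) ==> (t <= hamming (x i) (x j))%N].

Section Instance.
Variables (d m w : nat) (x : {ffun 'I_m -> Defs.point d}) (S : {ffun 'I_m -> wset d w}).

Definition ends (a : 'I_m * bool) : Defs.point d :=
  if a.2 then shift (x a.1) (val (S a.1)) else x a.1.

Lemma ends_pair i : hamming (ends (i, false)) (ends (i, true)) = w.
Proof. by rewrite /ends/= hamming_shift; apply/eqP/(valP (S i)). Qed.

Lemma ends_separated t i j : separated t x -> i != j ->
  (t <= hamming (ends (i, false)) (ends (j, true)) + w)%N.
Proof.
move=> /forallP/(_ i)/forallP/(_ j)/implyP sx /sx ij.
have := hamming_triangle (ends (j, true)) (x i) (x j).
rewrite (hammingC (ends _) (x j)) -[x j]/(ends (j, false)) ends_pair -[x i]/(ends (i, false)).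
exact: leq_trans.
Qed.

Definition empirical (p : Defs.point d) : R := avg (fun a => (ends a == p)%:R).

Lemma empirical_distr : (0 < m)%N -> is_distr empirical.
Proof.
move=> m0; split=> [p|].
  by rewrite /empirical avg_pred divr_ge0 ?ler0n.
rewrite /empirical -avg_sum -[RHS](@avg_cst _ ('I_m * bool)%type); last first.
  by rewrite card_prod card_ord card_bool muln_gt0 m0.
by apply: eq_avg => a; rewrite sumr_indicator.
Qed.

Lemma pr_neq_empirical f g :
  pr_neq empirical f g = avg (fun a => (f (ends a) != g (ends a))%:R).
Proof.
rewrite /pr_neq /empirical -avg_sum; by apply: eq_avg => a; rewrite sumr_indicator.
Qed.

Variable k : nat.
Let f := landscapeR k predT ends.

(** Each maximum of cones is 1-Lipschitz by itself; the danger is a move that descends from a peak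
    and enters a valley. Peaks and valleys are at least [2 * k] apart, so their cones of radius [k]
    only touch and the two changes share the length of the move. *)
Lemma instance_lipschitz : w = (2 * k)%N -> separated (8 * k) x -> Defs.lipschitz f.
Proof.
move=> wk sx.
have cross (a b : 'I_m * bool) : ~~ a.2 -> b.2 -> (2 * k <= hamming (ends a) (ends b))%N.
  case: a b => [i []]// [j []]// _ _.
  have [->|ij] := eqVneq i j; first by rewrite ends_pair wk.
  by rewrite -(leq_add2r w); apply: leq_trans (ends_separated sx ij); lia.
have onesided z z' : (landscape k predT ends z <= landscape k predT ends z' + hamming z z')%N.
  rewrite /landscape.
  set A := \max_(a | _) _; set B := \max_(a | _) _.
  set A' := \max_(a | _) _; set B' := \max_(a | _) _.
  have Bk : (B <= k)%N by apply/bigmax_leqP => a _; exact: leq_subr.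
  have Bk' : (B' <= k)%N by apply/bigmax_leqP => a _; exact: leq_subr.
  have h a := hamming_triangle z' z (ends a).
  have h' a := hamming_triangle z z' (ends a).
  have AA : (A <= A' + hamming z z')%N.
    apply/bigmax_leqP => a Pa.
    have : (k - hamming z' (ends a) <= A')%N by exact: leq_bigmax_cond.
    have := h' a; rewrite (hammingC z' z); lia.
  have BB : (B' <= B + hamming z z')%N.
    apply/bigmax_leqP => a Pa.
    have : (k - hamming z (ends a) <= B)%N by exact: leq_bigmax_cond.
    have := h a; lia.
  suff : (A + B' <= A' + B + hamming z z')%N by lia.
  (* If [A] or [B'] vanishes, one of [AA] and [BB] suffices. Otherwise [z] lies on the cone of a
     peak [a] and [z'] on that of a valley [b], and [A + B' <= hamming z z'] follows from the
     distance of [a] and [b]. *)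
  have [A0|A0] := posnP A; first by lia.
  have [B0|B0] := posnP B'; first by lia.
  have [a a2 EA] := bigmax_pos A0; have [b b2 EB] := bigmax_pos B0.
  have := cross a b a2 b2; have := hamming_triangle z (ends a) (ends b).
  have := hamming_triangle z' z (ends b); rewrite (hammingC (ends a) z).
  by move: A0 B0; rewrite /A /B' EA EB -/A -/B'; lia.
move=> z z'; rewrite real_ler_norml ?num_real//.
have := onesided z z'; have := onesided z' z; rewrite (hammingC z' z).
by rewrite /f /landscapeR -!(ler_nat R) !natrD; move: (hamming z z')%:R => h; lra.
Qed.

(** No valley reaches a peak and conversely, so the values at the ends are exactly [2 * k] and 0.
    They differ by more than the distance [2 * k - 1] of the pair, so a Lipschitz [g] misses at
    least one end, which is half the mass of the pair. *)
Lemma instance_far : (2 <= k)%N -> w.+1 = (2 * k)%N -> (0 < m)%N ->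
  separated (8 * k) x -> far f empirical (1 / 2).
Proof.
move=> k2 wk m0 sx g lg.
have cross (a b : 'I_m * bool) : ~~ a.2 -> b.2 -> (k <= hamming (ends a) (ends b))%N.
  case: a b => [i []]// [j []]// _ _.
  have [->|ij] := eqVneq i j; first by rewrite ends_pair; lia.
  by rewrite -(leq_add2r w); apply: leq_trans (ends_separated sx ij); lia.
have fhigh i : f (ends (i, false)) = (2 * k)%:R.
  rewrite /f /landscapeR /landscape; congr (_%:R).
  have -> : (\max_(a | predT a && ~~ a.2) (k - hamming (ends (i, false)) (ends a)) = k)%N.
    apply/eqP; rewrite eqn_leq; apply/andP; split.
      by apply/bigmax_leqP => a _; exact: leq_subr.
    by apply: leq_trans (leq_bigmax_cond (i, false) _) => //; rewrite hammingxx subn0.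
  rewrite big1 => [|a /= a2]; first by lia.
  by apply/eqP; rewrite subn_eq0 cross.
have flow i : f (ends (i, true)) = 0.
  rewrite /f /landscapeR /landscape -[RHS]/(0%:R); congr (_%:R).
  have -> : (\max_(a | predT a && a.2) (k - hamming (ends (i, true)) (ends a)) = k)%N.
    apply/eqP; rewrite eqn_leq; apply/andP; split.
      by apply/bigmax_leqP => a _; exact: leq_subr.
    by apply: leq_trans (leq_bigmax_cond (i, true) _) => //; rewrite hammingxx subn0.
  rewrite big1 => [|a /= a2]; first by lia.
  by apply/eqP; rewrite subn_eq0 hammingC cross.
rewrite pr_neq_empirical -(pair_avg (fun i b => (f (ends (i, b)) != g (ends (i, b)))%:R)).
rewrite -[leLHS](@avg_cst _ 'I_m) ?card_ord//; apply: avg_le => i.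
rewrite avg_bool half_le_or//.
apply: contraT; rewrite negb_or !negbK => /andP[/eqP gt /eqP gf].
have := lg (ends (i, false)) (ends (i, true)); rewrite -gt -gf fhigh flow subr0.
by rewrite ger0_norm ?ler0n// ler_nat ends_pair; lia.
Qed.

End Instance.

(** * Runs of a tester *)

Fixpoint queries d (st : strategy d) (f : Defs.point d -> R) (ss : nat -> Defs.point d)
    (fuel : nat) (hist : seq (response d)) (ns : nat) : seq (Defs.point d) :=
  if fuel is fuel'.+1 then
    match st hist with
    | AAccept | AReject => [::]
    | AQuery x => x :: queries st f ss fuel' (rcons hist (RVal d (f x))) ns
    | ASample => queries st f ss fuel' (rcons hist (RPt (ss ns))) ns.+1
    end
  else [::].

Lemma size_queries d (st : strategy d) f ss fuel hist nq ns b nq' ns' :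
  run st f ss fuel hist nq ns = Some (b, nq', ns') ->
  (nq + size (queries st f ss fuel hist ns))%N = nq'.
Proof.
elim: fuel hist nq ns => //= fuel IH hist nq ns.
case: (st hist) => [x| | |].
- by move/IH => <-; rewrite /= addnS addSn.
- by move/IH => <-.
- by case=> _ <- _; rewrite addn0.
- by case=> _ <- _; rewrite addn0.
Qed.

(** The history depends on the function only through the answers at the queried points, so the two
    runs never diverge. *)
Lemma run_agree d (st : strategy d) f g ss fuel hist nq ns :
  {in queries st f ss fuel hist ns, f =1 g} ->
  run st g ss fuel hist nq ns = run st f ss fuel hist nq ns.
Proof.
elim: fuel hist nq ns => //= fuel IH hist nq ns.
case: (st hist) => [x| | |]// fg.
- rewrite -(fg x) ?mem_head//; apply: IH => z zq; apply: fg.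
  by rewrite inE zq orbT.
- exact: IH.
Qed.

Definition verdict d (st : strategy d) f ss s q (b : bool) : bool :=
  if run0 st f ss s q is Some (b', _, _) then b' == b else false.

Definition queries0 d (st : strategy d) f ss s q := queries st f ss (s + q).+1 [::] 0.

Lemma verdict_eventE d Omega (T : Omega -> strategy d) f ss s q b w :
  `[< verdict_event T f ss s q b w >] = verdict (T w) f ss s q b.
Proof.
apply/asboolP/idP; rewrite /verdict_event /verdict /=.
  by move=> [nq [ns ->]]; rewrite eqxx.
case: (run0 _ _ _ _ _) => [[[b' nq] ns]|]// /eqP ->.
by exists nq, ns.
Qed.

Lemma verdict_agree d (st : strategy d) f g ss s q b :
  {in queries0 st f ss s q, f =1 g} -> verdict st g ss s q b = verdict st f ss s q b.
Proof. by move=> fg; rewrite /verdict /run0 (run_agree _ fg). Qed.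

Lemma verdict_unique d (st : strategy d) f ss s q :
  (verdict st f ss s q true)%:R + (verdict st f ss s q false)%:R <= 1 :> R.
Proof.
rewrite /verdict; case: (run0 _ _ _ _ _) => [[[b' nq] ns]|]; last by rewrite addr0 ler01.
by case: b'; rewrite ?add0r ?addr0.
Qed.

(** * Comparison with the null process *)

Lemma sumr_ord_le (K : realFieldType) n (F : 'I_n -> K) (c : K) :
  (forall i, F i <= c) -> \sum_(i < n) F i <= n%:R * c.
Proof.
move=> Fc; rewrite mulr_natl -[X in c *+ X]card_ord -sumr_const.
by apply: ler_sum => i _; exact: Fc.
Qed.

Section Indistinguishable.
Variables (d k m w s q : nat) (st : strategy d) (beta eta : R).
Hypothesis m_gt0 : (0 < m)%N.
Hypothesis wk : (w <= 2 * k)%N.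
Hypothesis wd : (w <= d)%N.
Hypothesis few_queries : forall f ss, ranged (2 * k) f ->
  (size (queries0 st f ss s q) <= q)%N.
Hypothesis ball_le : forall z : Defs.point d,
  avg (fun p => (hamming z p < 8 * k)%N%:R) <= beta.
Hypothesis near_le : forall z p : Defs.point d,
  avg (fun S : wset d w => (hamming z (shift p (val S)) < k)%N%:R) <= eta.

Local Notation config := {ffun 'I_m -> Defs.point d}.
Local Notation shifts := {ffun 'I_m -> wset d w}.
Local Notation draws := {ffun 'I_s -> 'I_m * bool}.

Lemma point_gt0 : (0 < #|{: Defs.point d}|)%N.
Proof. by rewrite card_point expn_gt0. Qed.

Lemma config_gt0 : (0 < #|{: config}|)%N.
Proof. by rewrite card_ffun expn_gt0 point_gt0. Qed.

Lemma wset_gt0 : (0 < #|{: wset d w}|)%N.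
Proof. by rewrite card_wset bin_gt0. Qed.

Lemma shifts_gt0 : (0 < #|{: shifts}|)%N.
Proof. by rewrite card_ffun expn_gt0 wset_gt0. Qed.

Lemma draws_gt0 : (0 < #|{: draws}|)%N.
Proof. by rewrite card_ffun expn_gt0 card_prod card_ord card_bool muln_gt0 m_gt0. Qed.

Lemma beta_ge0 : 0 <= beta.
Proof. by apply: le_trans (ball_le (pt0 d)); rewrite avg_pred divr_ge0 ?ler0n. Qed.

Lemma eta_ge0 : 0 <= eta.
Proof. by apply: le_trans (near_le (pt0 d) (pt0 d)); rewrite avg_pred divr_ge0 ?ler0n. Qed.

Lemma avg_not_separated :
  avg (fun x : config => (~~ separated (8 * k) x)%:R) <= m%:R * (m%:R * beta).
Proof.
apply: (@le_trans _ _ (avg (fun x : config =>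
    \sum_(i < m) \sum_(j < m) ((i != j) && (hamming (x j) (x i) < 8 * k)%N)%:R))).
  apply: avg_le => x.
  apply: (@le_trans _ _ (\sum_(i < m)
      [exists j, (i != j) && (hamming (x j) (x i) < 8 * k)%N]%:R)); last first.
    by apply: ler_sum => i _; exact: natr_exists_le.
  apply: le_trans (natr_exists_le _ _); rewrite ler_nat /separated negb_forall.
  case: existsP => // -[i]; rewrite negb_forall => /existsP[j]; rewrite negb_imply -ltnNge => ij.
  case: existsP => //; case; exists i; apply/existsP; exists j.
  by rewrite (hammingC (x j)).
rewrite avg_sum; apply: sumr_ord_le => i.
rewrite avg_sum; apply: sumr_ord_le => j.
(* Resample [x i] with the other points frozen: for [j != i] it has to fall into the fixed ball
   about [x j]. *)
apply: (avg_coord_le (i := i)) => [|x]; first exact: point_gt0.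
have [ij|ij] := eqVneq i j.
  rewrite (@eq_avg _ _ _ (fun=> 0)) ?avg_cst ?beta_ge0 ?point_gt0//.
apply: le_trans (ball_le (x j)); apply: avg_le => p.
by rewrite upd_same upd_other 1?eq_sym.
Qed.

Definition clash (J : draws) :=
  [exists j, exists j', (j != j') && ((J j).1 == (J j').1)].

(** Birthday bound: each of the at most [s * s] ordered pairs of draws has equal indices with
    probability [1 / m]. *)
Lemma avg_clash : avg (fun J => (clash J)%:R) <= s%:R * (s%:R / m%:R) :> R.
Proof.
apply: (@le_trans _ _ (avg (fun J : draws =>
    \sum_(j < s) \sum_(j' < s) ((j != j') && ((J j).1 == (J j').1))%:R))).
  apply: avg_le => J.
  apply: (@le_trans _ _ (\sum_(j < s)
      [exists j', (j != j') && ((J j).1 == (J j').1)]%:R)); last first.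
    by apply: ler_sum => i _; exact: natr_exists_le.
  exact: natr_exists_le.
rewrite avg_sum; apply: sumr_ord_le => j.
rewrite avg_sum; apply: sumr_ord_le => j'.
have ab0 : (0 < #|{: 'I_m * bool}|)%N by rewrite card_prod card_ord card_bool muln_gt0 m_gt0.
apply: (avg_coord_le (i := j)) => // J.
have [jj|jj] := eqVneq j j'.
  by rewrite (@eq_avg _ _ _ (fun=> 0)) ?avg_cst ?invr_ge0 ?ler0n.
rewrite (@eq_avg _ _ _ (fun a => (a.1 == (J j').1)%:R)); last first.
  by move=> a; rewrite upd_same upd_other 1?eq_sym.
rewrite -(pair_avg (fun i (b : bool) => (i == (J j').1)%:R)).
rewrite (@eq_avg _ _ _ (fun i => (i == (J j').1)%:R)); last first.
  by move=> i; rewrite avg_cst ?card_bool.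
by rewrite avg_pred card1 card_ord mul1r.
Qed.

(** * Coupling with the null process for fixed draws *)

Section FixedDraws.
Variable J : draws.

Definition sampled i := [exists j, (J j).1 == i].

(* What the tester sees when the partners of the sampled points, and all the
   pairs that were not sampled, are left out of the landscape. *)
Definition null_fun (p : config) := landscapeR k (mem (codom J)) (fun a => p a.1).
Definition null_samples (p : config) := seq_of_tuple [tuple p (J j).1 | j < s].
Definition null_queries (p : config) := queries0 st (null_fun p) (null_samples p) s q.
Definition null_verdict (p : config) b := verdict st (null_fun p) (null_samples p) s q b.

Lemma size_null_queries p : (size (null_queries p) <= q)%N.
Proof. by apply: few_queries; exact: landscape_ranged. Qed.

(** Neither the restricted landscape nor the samples involve [p i], so an unsampled point is
    independent of the null queries. *)
Lemma null_queries_upd p i a : ~~ sampled i -> null_queries (upd p i a) = null_queries p.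
Proof.
rewrite negb_exists => /forallP iJ; rewrite /null_queries; congr (queries0 st _ _ s q).
  apply/funext => z; congr (_%:R); apply: eq_landscape => b /codomP[j ->].
  by rewrite upd_other.
congr seq_of_tuple; apply: eq_from_tnth => j; rewrite !tnth_mktuple upd_other//.
Qed.

Definition hits_unsampled (p : config) :=
  [exists i, ~~ sampled i && has (fun z => hamming z (p i) < k)%N (null_queries p)].

(** Union bound over the indices and the null queries, where an unsampled [p i] is resampled with
    the queries frozen. The radius [k] is enlarged to [8 * k] so that [beta] applies. *)
Lemma avg_hits_unsampled :
  avg (fun p => (hits_unsampled p)%:R) <= m%:R * (q%:R * beta).
Proof.
apply: (@le_trans _ _ (avg (fun p : config => \sum_(i < m)
    (~~ sampled i && has (fun z => hamming z (p i) < k)%N (null_queries p))%:R))).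
  by apply: avg_le => p; exact: natr_exists_le.
rewrite avg_sum; apply: sumr_ord_le => i.
have qb0 : 0 <= q%:R * beta by rewrite mulr_ge0 ?ler0n ?beta_ge0.
case: (boolP (sampled i)) => [_|iJ].
  by rewrite avg_cst ?config_gt0.
apply: (avg_coord_le (i := i)) => [|p]; first exact: point_gt0.
apply: (@le_trans _ _ (avg (fun a => \sum_(z <- null_queries p) (hamming z a < k)%N%:R))).
  apply: avg_le => a; rewrite null_queries_upd// upd_same; exact: natr_has_le.
rewrite avg_sum; apply: le_trans (sumr_seq_le (c := beta) _ _) _ => [z|].
  apply: le_trans (ball_le z); apply: avg_le => p'; rewrite ler_nat.
  by case: ltnP => // zp; case: ltnP => //; lia.
by rewrite ler_wpM2r ?beta_ge0// ler_nat size_null_queries.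
Qed.

(** All indices count here, sampled or not: of an unsampled pair, the end [p i] is covered by
    [hits_unsampled] and the shifted end by this event. *)
Definition hits_partner (p : config) (S : shifts) :=
  has (fun z => [exists i, hamming z (shift (p i) (val (S i))) < k]%N) (null_queries p).

Lemma hamming_near z (p : config) (S : shifts) i :
  (hamming z (p i) <= hamming z (shift (p i) (val (S i))) + w)%N.
Proof.
apply: leq_trans (hamming_triangle (shift (p i) (val (S i))) _ _) _.
by rewrite leq_add2l hammingC hamming_shift (eqP (valP (S i))).
Qed.

(** The null queries do not depend on [S], and separation leaves each of them only one index to hit.
    This is why the bound has no factor [m]. *)
Lemma avg_hits_partner p : separated (8 * k) p ->
  avg (fun S => (hits_partner p S)%:R) <= q%:R * eta.
Proof.
move=> sp.
apply: (@le_trans _ _ (avg (fun S : shifts => \sum_(z <- null_queries p)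
    [exists i, hamming z (shift (p i) (val (S i))) < k]%N%:R))).
  by apply: avg_le => S; exact: natr_has_le.
rewrite avg_sum; apply: le_trans (sumr_seq_le (c := eta) _ _) _ => [z|]; last first.
  by rewrite ler_wpM2r ?eta_ge0// ler_nat size_null_queries.
(* A hit at [i] puts [z] within [k + w <= 3 * k] of [p i]. Together with [p i0] within [4 * k] this
   contradicts separation by [8 * k] unless [i = i0]. *)
case: (pickP (fun i => hamming z (p i) < 4 * k)%N) => [i0 zi0|far]; last first.
  rewrite (@eq_avg _ _ _ (fun=> 0)) ?avg_cst ?eta_ge0 ?shifts_gt0// => S.
  case: existsP => // -[i zi]; exfalso.
  by have := hamming_near z p S i; have := far i; lia.
apply: (avg_coord_le (i := i0)) => [|S]; first exact: wset_gt0.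
apply: le_trans (near_le z (p i0)); apply: avg_le => A; rewrite ler_nat.
case: existsP => // -[i]; have [->|ii0] := eqVneq i i0; first by rewrite upd_same => ->.
rewrite upd_other// => zi; exfalso.
have : (hamming z (p i) < k + w)%N.
  by apply: leq_ltn_trans (hamming_near z p S i) _; rewrite ltn_add2r.
have := hamming_triangle z (p i) (p i0).
move/forallP/(_ i)/forallP/(_ i0)/implyP/(_ ii0): sp; rewrite (hammingC (p i) z); lia.
Qed.

Definition bit i := [exists j, J j == (i, true)].

(* Exchanges the two ends of the pairs sampled at their shifted end, so that p i
   becomes the sampled end of every sampled pair i. *)
Definition orient (S : shifts) (p : config) : config :=
  [ffun i => if bit i then shift (p i) (val (S i)) else p i].

Lemma orientK S : involutive (orient S).
Proof.
by move=> p; apply/ffunP => i; rewrite !ffunE; case: (bit i) => //; rewrite shiftK.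
Qed.

Lemma ends_orient S p a : ends (orient S p) S a =
  if a.2 == bit a.1 then p a.1 else shift (p a.1) (val (S a.1)).
Proof.
case: a => i b; rewrite /ends ffunE /=.
by case: b (bit i) => [] []; rewrite //= shiftK.
Qed.

Hypothesis no_clash : ~~ clash J.

Lemma bit_draw j : (J j).2 = bit (J j).1.
Proof.
apply/idP/existsP => [Jj|[j' /eqP Jj']].
  by exists j; case: (J j) Jj => ? b /= ->.
suff -> : j = j' by rewrite Jj'.
apply/eqP; apply: contraNT no_clash => jj'.
by apply/existsP; exists j; apply/existsP; exists j'; rewrite jj' Jj' /=.
Qed.

Definition instance_verdict (J' : draws) (x : config) (S : shifts) b :=
  verdict st (landscapeR k predT (ends x S))
    (seq_of_tuple [tuple ends x S (J' j) | j < s]) s q b.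

(** After [orient], the samples of the instance are those of the null process. If no null query
    comes within [k] of an unsampled end, the answers agree as well. *)
Lemma instance_verdict_null p S b : ~~ hits_unsampled p -> ~~ hits_partner p S ->
  instance_verdict J (orient S p) S b = null_verdict p b.
Proof.
move=> nu np; rewrite /instance_verdict /null_verdict.
have -> : [tuple ends (orient S p) S (J j) | j < s] = [tuple p (J j).1 | j < s].
  by apply: eq_from_tnth => j; rewrite !tnth_mktuple ends_orient bit_draw eqxx.
apply: verdict_agree => z zq; congr (_%:R).
rewrite (@landscape_restrict _ _ _ (mem (codom J))) => [|a aJ].
  apply: eq_landscape => a /codomP[j ->].
  by rewrite ends_orient bit_draw eqxx.
(* An end outside [codom J] is either [p i] for an unsampled [i] or the shifted partner of some
   [p i]; the two hypotheses exclude one case each. *)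
rewrite ends_orient; case: eqP => [ab|ab]; rewrite leqNgt.
  apply: contra nu => za; apply/existsP; exists a.1; apply/andP; split; last first.
    by apply/hasP; exists z.
  apply: contra aJ => /existsP[j /eqP Jj]; apply/codomP; exists j.
  by move: ab (bit_draw j); rewrite -Jj; case: (a) (J j) Jj => ? ? [? ?] /= -> -> ->.
by apply: contra np => za; apply/hasP; exists z => //; apply/existsP; exists a.1.
Qed.

(** For each fixed [S], [orient S] permutes the uniform configurations, so the instance may be
    replaced by its oriented form and compared with the null process pointwise. The null average
    does not mention [w], so it serves both families. *)
Lemma instance_verdict_le_fixed b :
  avg (fun x => avg (fun S => (instance_verdict J x S b)%:R)) <=
  avg (fun p => (null_verdict p b)%:R)
    + (m%:R * (m%:R * beta) + m%:R * (q%:R * beta) + q%:R * eta) :> R.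
Proof.
rewrite exchange_avg.
rewrite (@eq_avg _ _ _ (fun S : shifts => avg (fun p =>
    (instance_verdict J (orient S p) S b)%:R))); last first.
  by move=> S; rewrite (reindex_avg _ (inv_inj (orientK S))).
rewrite exchange_avg.
have qe0 : 0 <= q%:R * eta by rewrite mulr_ge0 ?ler0n ?eta_ge0.
apply: (@le_trans _ _ (avg (fun p => (null_verdict p b)%:R + (~~ separated (8 * k) p)%:R
    + (hits_unsampled p)%:R + q%:R * eta))).
  apply: avg_le => p.
  have [sp|nsp] := boolP (separated (8 * k) p); last first.
    apply: (@le_trans _ _ 1); last first.
      rewrite -!addrA addrCA -[(~~ false)%:R]/(1 : R) lerDl.
      by rewrite !addr_ge0 ?ler0n.
    by apply: avg_le_cst => [|S]; [exact: shifts_gt0|rewrite -[leRHS]/(1%:R) ler_nat leq_b1].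
  apply: (@le_trans _ _ (avg (fun S => (null_verdict p b)%:R + (hits_unsampled p)%:R
      + (hits_partner p S)%:R))).
    apply: avg_le => S; rewrite -!natrD ler_nat.
    have [//|nu] := boolP (hits_unsampled p).
      by case: instance_verdict; lia.
    have [//|np] := boolP (hits_partner p S).
      by case: instance_verdict; lia.
    by rewrite instance_verdict_null// -addnA leq_addr.
  rewrite avgD avg_cst ?shifts_gt0// -[(~~ true)%:R]/(0 : R) addr0 lerD2l.
  exact: avg_hits_partner.
rewrite !avgD avg_cst ?config_gt0// -!addrA lerD2l !addrA lerD2r.
by apply: lerD; [exact: avg_not_separated|exact: avg_hits_unsampled].
Qed.

End FixedDraws.

Lemma instance_verdict_le b :
  avg (fun x => avg (fun S => avg (fun J => (instance_verdict J x S b)%:R))) <=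
  avg (fun J => avg (fun p => (null_verdict J p b)%:R)) + (s%:R * (s%:R / m%:R)
    + m%:R * (m%:R * beta) + m%:R * (q%:R * beta) + q%:R * eta) :> R.
Proof.
rewrite (@eq_avg _ _ _ (fun x => avg (fun J => avg (fun S =>
    (instance_verdict J x S b)%:R)))); last by move=> x; rewrite exchange_avg.
rewrite exchange_avg.
apply: (@le_trans _ _ (avg (fun J => avg (fun p => (null_verdict J p b)%:R) + (clash J)%:R
  + (m%:R * (m%:R * beta) + m%:R * (q%:R * beta) + q%:R * eta)))); last first.
  rewrite !avgD !avg_cst ?draws_gt0// -!addrA lerD2l.
  by apply: lerD => //; exact: avg_clash.
apply: avg_le => J; have [cJ|nJ] := boolP (clash J); last first.
  by rewrite -[(false)%:R]/(0 : R) addr0 instance_verdict_le_fixed.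
apply: (@le_trans _ _ 1).
  apply: avg_le_cst => [|x]; first exact: config_gt0.
  apply: avg_le_cst => [|S]; first exact: shifts_gt0.
  by rewrite -[leRHS]/(1%:R) ler_nat leq_b1.
rewrite -[true%:R]/(1 : R) addrAC lerDr !addr_ge0//.
- by rewrite avg_pred divr_ge0 ?ler0n.
- by rewrite !mulr_ge0 ?ler0n ?beta_ge0.
- by rewrite !mulr_ge0 ?ler0n ?beta_ge0.
- by rewrite mulr_ge0 ?ler0n ?eta_ge0.
Qed.

End Indistinguishable.

(** * A tester against the Lipschitz and the far family *)

Section TwoFamilies.
Variables (d k m s q : nat) (md : measure_display) (Omega : measurableType md).
Variables (P : probability Omega R) (T : Omega -> strategy d) (beta eta : R).
Hypothesis m_gt0 : (0 < m)%N.
Hypothesis k_gt1 : (1 < k)%N.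
Hypothesis kd : (2 * k <= d)%N.
Hypothesis bounded : complexity_bounded (2 * k) T s q.
Hypothesis measurableT : measurable_tester (2 * k) T s q.
Hypothesis tester : lip_tester (2 * k) P T s q (1 / 2).
Hypothesis ball_le : forall z : Defs.point d,
  avg (fun p => (hamming z p < 8 * k)%N%:R) <= beta.
Hypothesis near_le : forall w (z p : Defs.point d), (2 * k <= w.+1)%N -> (w <= 2 * k)%N ->
  avg (fun S : wset d w => (hamming z (shift p (val S)) < k)%N%:R) <= eta.

Local Notation config := {ffun 'I_m -> Defs.point d}.
Local Notation shifts w := {ffun 'I_m -> wset d w}.
Local Notation draws := {ffun 'I_s -> 'I_m * bool}.

Definition instance_event w b (u : config * (shifts w * draws)) : set Omega :=
  verdict_event T (landscapeR k predT (ends u.1 u.2.1))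
    (seq_of_tuple [tuple ends u.1 u.2.1 (u.2.2 j) | j < s]) s q b.

Definition instance_prob w b : R :=
  avg (fun u : config * (shifts w * draws) => fine (P (instance_event b u))).

Lemma instance_probE w b : instance_prob w b = avg (fun x : config => avg (fun S : shifts w =>
  verdict_prob P T (landscapeR k predT (ends x S)) (empirical x S) s q b)).
Proof.
rewrite /instance_prob -(pair_avg (fun x (v : shifts w * draws) =>
  fine (P (instance_event b (x, v))))).
apply: eq_avg => x.
rewrite -(pair_avg (fun (S : shifts w) (J : draws) => fine (P (instance_event b (x, (S, J)))))).
by apply: eq_avg => S; rewrite /verdict_prob /empirical empirical_sample.
Qed.

Lemma few_queries w f ss : ranged (2 * k) f -> (size (queries0 (T w) f ss s q) <= q)%N.
Proof.
move=> rf; have [b [nq [ns [E [nqq _]]]]] := bounded w rf ss.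
by rewrite -[size _]add0n /queries0 (size_queries E).
Qed.

(** The guarantee of the tester is used on separated configurations only; the others are counted as
    0, which loses at most their probability. *)
Lemma instance_prob_ge w b : (w <= d)%N ->
  (forall (x : config) (S : shifts w), separated (8 * k) x ->
    2 / 3 <= verdict_prob P T (landscapeR k predT (ends x S)) (empirical x S) s q b) ->
  2 / 3 * (1 - m%:R * (m%:R * beta)) <= instance_prob w b.
Proof.
move=> wd good; rewrite instance_probE.
apply: (@le_trans _ _ (avg (fun x : config => 2 / 3 * (1 - (~~ separated (8 * k) x)%:R)))).
  rewrite avgZ ler_wpM2l ?divr_ge0 ?ler0n//.
  by rewrite avgB avg_cst ?lerB ?config_gt0//; exact: avg_not_separated.
apply: avg_le => x.
rewrite -[leLHS](@avg_cst _ (shifts w)); last exact: shifts_gt0.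
apply: avg_le => S.
case: (boolP (separated (8 * k) x)) => [sx|_].
  by rewrite -[(~~ true)%:R]/(0 : R) subr0 mulr1; exact: good.
rewrite -[(~~ false)%:R]/(1 : R) subrr mulr0.
apply: sumr_ge0 => t _; rewrite mulr_ge0 ?fine_ge0//.
rewrite prodr_ge0// => i _; rewrite /empirical avg_pred divr_ge0 ?ler0n//.
Qed.

(** For each seed, both families are compared with the same null process, in which accepting and
    rejecting exclude each other. Hence the sum is at most 1 plus the comparison error, paid
    twice. *)
Lemma instance_prob_sum_le :
  instance_prob (2 * k) true + instance_prob (2 * k).-1 false <=
  1 + 2 * (s%:R * (s%:R / m%:R) + m%:R * (m%:R * beta) + m%:R * (q%:R * beta) + q%:R * eta).
Proof.
apply: avg_prob_le => [u|u|w].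
- by apply: measurableT; exact: landscape_ranged.
- by apply: measurableT; exact: landscape_ranged.
have upper v b : (2 * k <= v.+1)%N -> (v <= 2 * k)%N ->
    avg (fun u : config * (shifts v * draws) => `[< instance_event b u w >]%:R) <=
    avg (fun J : draws => avg (fun p : config => (null_verdict k q (T w) J p b)%:R)) +
    (s%:R * (s%:R / m%:R) + m%:R * (m%:R * beta) + m%:R * (q%:R * beta) + q%:R * eta) :> R.
  move=> kv vk.
  rewrite -(pair_avg (fun x (t : shifts v * draws) => `[< instance_event b (x, t) w >]%:R)).
  rewrite (@eq_avg _ _ _ (fun x : config => avg (fun S : shifts v => avg (fun J : draws =>
    (instance_verdict k q (T w) J x S b)%:R)))); last first.
    move=> x; rewrite -(pair_avg (fun S (J : draws) => `[< instance_event b (x, (S, J)) w >]%:R)).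
    by apply: eq_avg => S; apply: eq_avg => J; rewrite verdict_eventE.
  apply: instance_verdict_le => //; first exact: leq_trans kd.
    by move=> f ss; exact: few_queries.
  by move=> z p; exact: near_le.
have null_sum :
    avg (fun J : draws => avg (fun p : config => (null_verdict k q (T w) J p true)%:R)) +
    avg (fun J : draws => avg (fun p : config => (null_verdict k q (T w) J p false)%:R)) <= 1 :> R.
  rewrite -avgD; apply: avg_le_cst => [|J]; first exact: draws_gt0.
  rewrite -avgD; apply: avg_le_cst => [|p]; first exact: config_gt0.
  exact: verdict_unique.
have h1 := upper (2 * k)%N true (leqnSn _) (leqnn _).
have h2 : _ <= _ := upper (2 * k).-1 false _ (leq_pred _).
apply: le_trans (lerD h1 (h2 _)) _; first by lia.
rewrite addrACA lerD// mulr2n mulrDl mul1r//.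
Qed.

Lemma tester_error_bound :
  4 / 3 * (1 - m%:R * (m%:R * beta)) <=
  1 + 2 * (s%:R * (s%:R / m%:R) + m%:R * (m%:R * beta) + m%:R * (q%:R * beta) + q%:R * eta).
Proof.
apply: le_trans instance_prob_sum_le.
have yes := @instance_prob_ge (2 * k) true kd.
have no : _ -> _ := @instance_prob_ge (2 * k).-1 false (leq_trans (leq_pred _) kd).
have -> : 4 / 3 * (1 - m%:R * (m%:R * beta)) =
  2 / 3 * (1 - m%:R * (m%:R * beta)) + 2 / 3 * (1 - m%:R * (m%:R * beta)) by lra.
apply: lerD; [apply: yes|apply: no] => x S sx.
- apply: tester.1; [exact: landscape_ranged|exact: empirical_distr|exact: instance_lipschitz].
- apply: tester.2; [exact: landscape_ranged|exact: empirical_distr|].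
  apply: instance_far => //; lia.
Qed.

End TwoFamilies.

(** * Numerical estimates *)

(** Fourth power of [17 ^ 2 = 289 <= 512 = 2 ^ 9]. *)
Lemma pow17 : (17 ^ 8 <= 2 ^ 36)%N.
Proof. by rewrite (expnM 17 2 4) (expnM 2 9 4) leq_exp2r. Qed.

(** The ball has at most [(17 / 16) ^ d * 16 ^ (8 * k)] points, where [17 / 16] is at most the
    square root of 2 and [16 ^ (8 * k)] is at most 2 to the [d / 8]. The eighth power clears the
    exponent [5 * d / 8]. *)
Lemma hball_exp8 d k (z : Defs.point d) : (256 * k <= d)%N ->
  (#|hball z (8 * k)| ^ 8 <= 2 ^ (5 * d))%N.
Proof.
move=> kd; have kd8 : (8 * k <= d)%N by lia.
have := hball_bound z kd8; set h := #|_| => hb.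
have {}hb : (h * 16 ^ d <= 17 ^ d * 16 ^ (8 * k))%N.
  by rewrite -[in X in (X <= _)%N](subnK kd8) expnD mulnA leq_mul2r hb orbT.
rewrite -(@leq_pmul2r (2 ^ (32 * d))) ?expn_gt0// -expnD.
have -> : (2 ^ (32 * d) = (16 ^ d) ^ 8)%N by rewrite -[16%N]/(2 ^ 4)%N -!expnM; congr expn; lia.
rewrite -expnMn; apply: (@leq_trans ((17 ^ d * 16 ^ (8 * k)) ^ 8)%N); first by rewrite leq_exp2r.
have -> : (5 * d + 32 * d = 36 * d + d)%N by lia.
rewrite expnMn expnD leq_mul//.
  rewrite -expnM mulnC expnM [leqRHS]expnM; apply: leq_exp; exact: pow17.
by rewrite (_ : 16 = 2 ^ 4)%N// -!expnM leq_exp2l//; lia.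
Qed.

Section Estimates.
Variable K : realFieldType.
Implicit Types X Y : K.

Lemma hball_avg_le d k X (z : Defs.point d) : (256 * k <= d)%N -> 0 < X -> X ^+ 32 = 2 ^+ d ->
  avg (fun p => (hamming z p < 8 * k)%N%:R : K) <= X ^- 12.
Proof.
move=> kd X0 Xd; rewrite avg_pred card_point natrX -Xd.
rewrite ler_pdivrMr ?exprn_gt0// (exprD _ 12 20) mulrA mulVf ?mul1r ?expf_neq0 ?gt_eqF//.
have X20 : 0 <= X ^+ 20 by rewrite exprn_ge0 ?ltW.
rewrite -(@ler_pXn2r _ 8) ?nnegrE ?ler0n// -exprM (exprM X 32 5) Xd.
by rewrite -!natrX ler_nat -expnM (mulnC d); exact: hball_exp8.
Qed.

(** [near_sets_bound] gives at most [4 ^ k * (2 * k / d) ^ k = 4 ^ k * X ^- 16], and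
    [2 ^ 16 <= d / (2 * k)] makes [4 ^ k] at most [X ^ 2]. *)
Lemma near_avg_le d k w X (z p : Defs.point d) : (0 < k)%N -> (2 ^ 16 * (2 * k) <= d)%N ->
  (2 * k <= w.+1)%N -> (w <= 2 * k)%N -> 0 < X -> X ^+ 32 = (d%:R / (2 * k)%:R) ^+ (2 * k) ->
  avg (fun S : wset d w => (hamming z (shift p (val S)) < k)%N%:R : K) <= X ^- 14.
Proof.
move=> k0 kd kw wk X0 Xd.
have d0 : 0 < d%:R :> K by rewrite ltr0n; lia.
have r0 : 0 < (2 * k)%:R :> K by rewrite ltr0n; lia.
have wd : (w <= d)%N by lia.
have v0 : 0 <= d%:R / (2 * k)%:R :> K by rewrite divr_ge0 ?ltW.
have X0' := ltW X0.
have Xk : X ^+ 16 = (d%:R / (2 * k)%:R) ^+ k.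
  apply/eqP; rewrite -(@eqrXn2 _ 2) ?exprn_ge0// -!exprM (mulnC k) Xd//.
have vk : 2 ^+ 16 <= d%:R / (2 * k)%:R :> K.
  by rewrite ler_pdivlMr// -natrX -natrM ler_nat.
have X2 : 4 ^+ k <= X ^+ 2.
  rewrite -(@ler_pXn2r _ 8) ?nnegrE ?exprn_ge0 ?ler0n// -!exprM Xk mulnC exprM.
  rewrite ler_pXn2r ?nnegrE ?exprn_ge0 ?ler0n// (le_trans _ vk)// -!natrX ler_nat//.
rewrite avg_pred card_wset.
set N := #|_|.
have NE : (N <= #|[set S : {set 'I_d} | #|S| == w & hamming z (shift p S) < k]%N|)%N.
  rewrite /N -(fintype.card_image val_inj); apply/subset_leq_card/fintype.subsetP => S.
  by move=> /fintype.imageP[A Ap ->]; rewrite inE (valP A).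
have {NE} Nb : (N * d ^ k <= 4 ^ k * (2 * k) ^ k * 'C(d, w))%N.
  apply: leq_trans (leq_mul NE (leqnn _)) _; apply: leq_trans (near_sets_bound _ _ kw wd) _.
  rewrite leq_mul2r leq_mul ?orbT//; last exact: leq_exp.
  by rewrite -[4%N]/(2 ^ 2)%N -expnM leq_exp2l.
have C0 : 0 < 'C(d, w)%:R :> K by rewrite ltr0n bin_gt0.
have rk0 : 0 < (2 * k)%:R ^+ k :> K by rewrite exprn_gt0.
have dk : d%:R ^+ k = X ^+ 16 * (2 * k)%:R ^+ k.
  by rewrite Xk -exprMn divfK ?gt_eqF.
rewrite ler_pdivrMr// ler_pdivlMl ?exprn_gt0//.
rewrite -(ler_pM2r (exprn_gt0 2 X0)) -(ler_pM2r rk0).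
apply: (@le_trans _ _ (4 ^+ k * (2 * k)%:R ^+ k * 'C(d, w)%:R)).
  have -> : X ^+ 14 * N%:R * X ^+ 2 * (2 * k)%:R ^+ k = N%:R * d%:R ^+ k.
    by rewrite dk (exprD X 14 2); move: (_ ^+ k) => y; ring.
  by rewrite -!natrX -!natrM ler_nat.
by rewrite -[leRHS]mulrA [leRHS]mulrC !ler_pM2r.
Qed.

(** Both sides are separated by ['C(d, r)]. This makes the query threshold at most the sample
    threshold. *)
Lemma pow_ratio_le d r : (0 < r)%N -> (r <= d)%N -> (d%:R / r%:R) ^+ r <= 2 ^+ d :> K.
Proof.
move=> r0 rd; rewrite expr_div_n ler_pdivrMr ?exprn_gt0 ?ltr0n//.
rewrite -!natrX -natrM ler_nat mulnC.
have := bin_ratio (leqnn r) rd; rewrite subnn bin0 muln1 => h.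
apply: leq_trans h _; rewrite leq_mul2l; apply/orP; right.
rewrite -card_wset; apply: leq_trans (leq_card val val_inj) _.
by rewrite -cardsT -powersetT card_powerset cardsT card_ord.
Qed.

(** The choice of [m] settles the clash term and keeps [m] below [41 * X ^ 2]; the successor keeps
    it positive when [s = 0]. The next two terms are then of order at most [X ^- 8]. *)
Lemma error_small X Y (s q m : nat) : 8 <= X -> 4 <= Y -> Y <= X -> s%:R < X -> q%:R < Y ->
  m = (40 * s ^ 2).+1 ->
  [/\ s%:R * (s%:R / m%:R) <= 1 / 40 :> K, m%:R * (m%:R * X ^- 12) <= 1 / 40,
      m%:R * (q%:R * X ^- 12) <= 1 / 40 & q%:R * Y ^- 14 <= 1 / 40].
Proof.
move=> X8 Y4 YX sX qY mE.
have X0 : 0 < X by lra. have Y0 : 0 < Y by lra.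
have m0 : 0 < m%:R :> K by rewrite mE ltr0n.
have s0 := ler0n K s; have q0 := ler0n K q.
have mR : m%:R = 40 * s%:R ^+ 2 + 1 :> K by rewrite mE -natr1 natrM natrX.
have sX2 : s%:R ^+ 2 <= X ^+ 2 by rewrite ler_sqr ?nnegrE ?(ltW X0) ?(ltW sX).
have X2 : 64 <= X ^+ 2 by nra.
have mX : m%:R <= 41 * X ^+ 2 by rewrite mR; lra.
have X4 : 4096 <= X ^+ 4 by rewrite (exprM X 2 2); nra.
have qX : q%:R <= X ^+ 2 by nra.
have inv12 (a b : K) : 0 <= a -> 0 <= b -> a <= 41 * X ^+ 2 -> b <= 41 * X ^+ 2 ->
    a * (b * X ^- 12) <= 1 / 40.
  move=> a0 b0 aX bX; rewrite mulrA ler_pdivrMr ?exprn_gt0//.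
  apply: (@le_trans _ _ ((41 * X ^+ 2) * (41 * X ^+ 2))); first exact: ler_pM.
  rewrite (exprM X 4 3); move: (X ^+ 4) X4 (exprM X 2 2) => u u0 E.
  have -> : 41 * X ^+ 2 * (41 * X ^+ 2) = 1681 * u by rewrite E; ring.
  have : u * u >= 4096 * u by nra.
  by rewrite !exprS expr0 mulr1; nra.
split.
- by rewrite mulrA ler_pdivrMr// mR; lra.
- exact: inv12.
- by apply: inv12 => //; lra.
- rewrite ler_pdivrMr ?exprn_gt0//.
  have Y3 : 64 <= Y ^+ 3 by rewrite !exprS expr0 mulr1; nra.
  have : 1 <= Y ^+ 10 by rewrite exprn_ege1//; lra.
  have -> : Y ^+ 14 = Y ^+ 10 * Y ^+ 3 * Y by rewrite -exprD -exprSr.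
  move: (Y ^+ 10) (Y ^+ 3) Y3 => u v v64 u1.
  have uv : 64 <= u * v by nra.
  by have : 64 * Y <= u * v * Y by [rewrite ler_pM2r|]; lra.
Qed.

End Estimates.

(** The left side is at least [4 / 3 * (39 / 40) = 1.3], the right side at most
    [1 + 2 * (4 / 40) = 1.2]. *)
Lemma error_budget (K : realFieldType) (clash sep unsampled partner : K) :
  clash <= 1 / 40 -> sep <= 1 / 40 -> unsampled <= 1 / 40 -> partner <= 1 / 40 ->
  ~ 4 / 3 * (1 - sep) <= 1 + 2 * (clash + sep + unsampled + partner).
Proof. by lra. Qed.

Lemma powR_root32 (K : realType) (a : K) n : 0 <= a -> (a `^ (32^-1 * n%:R)) ^+ 32 = a ^+ n.
Proof.
move=> a0; rewrite -powR_mulrn ?powR_ge0// -powRrM mulrAC mulVf ?mul1r ?powR_mulrn// ?pnatr_eq0//.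
Qed.

Theorem theorem4p3 :
  exists c : R, 0 < c /\
  exists d0 : nat, forall d : nat, (d0 <= d)%N ->
  forall r : nat, ~~ odd r -> (4 <= r)%N -> (r%:R : R) <= 2 ^- 16 * d%:R ->
  forall (md : measure_display) (Omega : measurableType md)
         (P : probability Omega R) (T : Omega -> strategy d) (s q : nat),
    complexity_bounded r T s q ->
    measurable_tester r T s q ->
    lip_tester r P T s q (1 / 2) ->
    (2 `^ (c * d%:R) <= (s%:R : R)) \/ ((d%:R / r%:R) `^ (c * r%:R) <= (q%:R : R)).
Proof.
(* With [c = 1 / 32] the thresholds are 32nd roots of [2 ^ d] and [(d / r) ^ r], so that the
   estimates need integer powers only. *)
exists 32^-1; split; first by rewrite invr_gt0 ltr0n.
(* The bounds on [r] force [2 ^ 18 <= d], which is the largeness of [d] that the estimates rely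
   on. *)
exists 0%N => d _ r r_even r4 rd md Omega P T s q bT mT tT.
have {r_even} rk : r = (2 * r./2)%N by rewrite mul2n even_halfK.
move: (r./2) rk => k rk; subst r.
have {}rd : (2 ^ 16 * (2 * k) <= d)%N.
  by move: rd; rewrite ler_pdivlMl ?exprn_gt0 ?ltr0n// -natrX -natrM ler_nat.
have k0 : (0 < k)%N by lia.
have d0 : (0 < d)%N by lia.
have k1 : (1 < k)%N by lia.
have kd : (2 * k <= d)%N by lia.
have kd' : (256 * k <= d)%N by lia.
set X := 2 `^ _; set Y := _ `^ _.
case: (leP X s%:R) => [|sX]; first by left.
case: (leP Y q%:R) => [|qY]; first by right.
exfalso.
have r_gt0 : 0 < (2 * k)%:R :> R by rewrite ltr0n; lia.
have v0 : 0 < d%:R / (2 * k)%:R :> R by apply: divr_gt0 => //; rewrite ltr0n.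
have X0 : 0 < X by rewrite powR_gt0 ?ltr0n.
have Y0 : 0 < Y by rewrite powR_gt0.
have Xd : X ^+ 32 = 2 ^+ d by rewrite powR_root32 ?ler0n.
have Yd : Y ^+ 32 = (d%:R / (2 * k)%:R) ^+ (2 * k) by exact: powR_root32 (ltW v0).
have X8 : 8 <= X.
  rewrite -(@ler_pXn2r _ 32) ?nnegrE ?(ltW X0)// Xd.
  rewrite (_ : 8 = 2 ^+ 3) -?exprM; last by rewrite -natrX.
  by apply: ler_weXn2l; [rewrite ler1n|lia].
have Y4 : 4 <= Y.
  rewrite -(@ler_pXn2r _ 32) ?nnegrE ?(ltW Y0)// Yd.
  apply: (@le_trans _ _ ((2 ^+ 16) ^+ (2 * k))).
    rewrite (_ : 4 = 2 ^+ 2) -?exprM; last by rewrite -natrX.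
    by apply: ler_weXn2l; [rewrite ler1n|lia].
  rewrite ler_pXn2r ?nnegrE ?(ltW v0) ?exprn_ge0//; last lia.
  by rewrite ler_pdivlMr// -natrX -natrM ler_nat.
have YX : Y <= X.
  rewrite -(@ler_pXn2r _ 32) ?nnegrE ?(ltW X0) ?(ltW Y0)// Xd Yd.
  by apply: pow_ratio_le; lia.
(* Here [erefl] fixes the number of pairs as [m = (40 * s ^ 2).+1]. *)
have [e1 e2 e3 e4] := error_small X8 Y4 YX sX qY (erefl _).
have ball (z : Defs.point d) := hball_avg_le z kd' X0 Xd.
have near w (z p : Defs.point d) (kw : (2 * k <= w.+1)%N) (wk : (w <= 2 * k)%N) :=
  near_avg_le z p k0 rd kw wk Y0 Yd.
exact: (error_budget e1 e2 e3 e4 (tester_error_bound (ltn0Sn _) k1 kd bT mT tT ball near)).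
Qed.
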